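(* Let $d>1$ be a square-free integer, let $R=\mathbb{Z}[\delta]$ with $\delta\notin\mathbb{Z}$ be a subring of the ring of integers of $\mathbb{Q}[\sqrt d]$, and let $\Lambda=\{(\alpha,\overline\alpha):\alpha\in R\}\subset\mathbb{R}^2$ be the associated lattice. Then $$\mathrm{disp}(\Lambda)=\Bigl(\frac{\det(\Lambda)}{2}+1\Bigr)^2-\frac r4=\Bigl(\frac{\sqrt{\mathrm{disc}(R)}}{2}+1\Bigr)^2-\frac r4,$$ where $r\in\{0,1\}$ and $r\equiv\det(\Lambda)^2\pmod 2$.
   Context: For $\alpha=u+v\sqrt d$ with $u,v\in\mathbb{Q}$, the conjugate is $\overline\alpha=u-v\sqrt d$. The ring of integers of $\mathbb{Q}[\sqrt d]$ is $\mathbb{Z}[\delta_d]$ with $\delta_d=\sqrt d$ if $d\equiv2,3\pmod4$ and $\delta_d=\frac{1+\sqrt d}{2}$ if $d\equiv1\pmod 4$. The lattice $\Lambda$ is generated by $(1,1)$ and $(\delta,\overline\delta)$; $\det(\Lambda)>0$ is its covolume, i.e. $|\delta-\overline\delta|$, and $\mathrm{disc}(R)=\det(\Lambda)^2$, which is an integer. The dispersion $\mathrm{disp}(\Lambda)$ is the supremum of the areas of all open axis-parallel boxes in $\mathbb{R}^2$ that contain no point of $\Lambda$. *)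

(* Defs.v *)
From HB Require Import structures.
From mathcomp Require Import all_boot all_order all_algebra.
From mathcomp Require Import all_classical all_reals ereal.

Set Implicit Arguments.
Unset Strict Implicit.
Unset Printing Implicit Defensive.

Import Order.TTheory GRing.Theory Num.Theory.

Local Open Scope classical_set_scope.
Local Open Scope ring_scope.

Definition squarefree (d : nat) : Prop :=
  forall k : nat, (1 < k)%N -> ~~ (k ^ 2 %| d)%N.

Section Quadratic.
Context {R : realType}.
Variable d : nat.

(* The pair (u, v) represents u + v sqrt d; for squarefree d > 1 this
   representation is unique, so that conjugation, which is defined on pairs,
   is well defined on the elements of Q[sqrt d]. *)
Definition quad_val (a : rat * rat) : R :=
  ratr a.1 + ratr a.2 * Num.sqrt (d%:R : R).

Definition quad_conj (a : rat * rat) : rat * rat := (a.1, - a.2).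

Definition quad_field : set R := range quad_val.

Definition quad_integers : set R :=
  [set x | quad_field x /\ integralOver (intr : int -> R) x].

Definition conj_lattice (O : set R) : set (R * R) :=
  [set (quad_val a, quad_val (quad_conj a)) | a in [set a | O (quad_val a)]].

End Quadratic.

Section Plane.
Context {R : realType}.

(* Z[delta], the set of values at delta of integer polynomials *)
Definition int_adjoin (delta : R) : set R :=
  range (fun p : {poly int} => (map_poly intr p).[delta]).

Definition int_span (b c : R * R) : set (R * R) :=
  range (fun m : int * int => b *~ m.1 + c *~ m.2).

Definition det2 (b c : R * R) : R := b.1 * c.2 - b.2 * c.1.

Definition is_lattice_basis (L : set (R * R)) (b c : R * R) : Prop :=
  det2 b c != 0 /\ L = int_span b c.

(* Covolume: the common value of `|det2 b c| over all Z-bases (b, c) of L;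
   by convention 0 if L is not a lattice of rank two. *)
Definition lattice_det (L : set (R * R)) : R :=
  xget 0 [set D | exists b c, is_lattice_basis L b c /\ D = `|det2 b c|].

(* The boxes are bounded; an unbounded open box is an increasing union of
   bounded ones, so that allowing it would not change the supremum. *)
Definition disp (L : set (R * R)) : \bar R :=
  ereal_sup [set D | exists a1 b1 a2 b2 : R,
    [/\ a1 < b1, a2 < b2,
        (`]a1, b1[%classic `*` `]a2, b2[%classic) `&` L = set0
      & D = ((b1 - a1) * (b2 - a2))%:E]].

(* disc(O) is taken to be the square of the covolume of the lattice of O, a real
   number which is in fact an integer. *)
Definition order_disc (d : nat) (O : set R) : R :=
  lattice_det (conj_lattice d O) ^+ 2.

End Plane.

(* Main.v *)
Require Import Defs.
From HB Require Import structures.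
From mathcomp Require Import all_boot all_order all_algebra.
From mathcomp Require Import all_classical all_reals ereal.
From mathcomp Require Import ring lra zify.
Set Implicit Arguments.
Unset Strict Implicit.
Unset Printing Implicit Defensive.
Import Order.TTheory GRing.Theory Num.Theory.
Local Open Scope classical_set_scope.
Local Open Scope ring_scope.

(** The dispersion of a lattice with no nonzero point on the axes can be read
off its bases (e, f) whose first vector points into the open first quadrant and
whose second vector points into the open fourth one.  The open box with the
points 0 and e + f on its left and right sides and f and e on its bottom and top
sides is empty, because no lattice point m e + n f satisfies the four
inequalities ([straddling_box_free]).  Its area is
[(e.1 + f.1) * (e.2 - f.2) = N e - N f + det], where [N p = p.1 * p.2].

For a quadratic order, N is the norm, which takes integer values.  In the
coordinates of (e, f) it is a form a X^2 + b X Y - c Y^2 with integers a, c >= 1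
and discriminant b^2 + 4 a c = det^2.  Hence
a + c <= 1 + a c = 1 + (det^2 - b^2) / 4, and b has the parity r of det^2, so
that the area is at most 1 + det + (det^2 - r) / 4 = (det / 2 + 1)^2 - r / 4
([straddling_area_le]).  The basis formed by 1 and the generator w of trace r
with w > 0 > w' has a = 1 and b = r, hence attains the bound
([unit_basis_disp]).

It remains to see that no empty box is larger than all of these.  Replacing
(e, f) by (e + f, f) or (e, e + f), whichever still straddles the horizontal
axis, gives a chain of bases along which the widths e.1 + f.1 increase to
infinity ([straddling_step]).  Climbing by e or by - f inside a vertical strip
of width more than e.1 + f.1 shows that an empty box in such a strip has height
at most max(e.2, - f.2), the height of the box of the next basis in the chain
([box_free_height_le]).  So a box whose width lies between those of two
consecutive bases is bounded by the area of the second one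
([wide_box_area_le]).  A box narrower than the box of the initial basis is
either shorter as well, or is handled by exchanging the coordinates
([box_area_le]). *)

(** * Integer spans and bases of plane lattices *)

Section PlaneLattices.
Context {R : realType}.
Implicit Types (L : set (R * R)) (e f p q : R * R).

Lemma int_combE e f (m n : int) : e *~ m + f *~ n =
  (m%:~R * e.1 + n%:~R * f.1, m%:~R * e.2 + n%:~R * f.2).
Proof. by rewrite !mulrzl -!(raddfMz fst) -!(raddfMz snd). Qed.

Definition span_closed L := forall p q, L p -> L q -> int_span p q `<=` L.

Lemma span_closedD L p q : span_closed L -> L p -> L q -> L (p + q).
Proof. by move=> Lc Lp Lq; apply: (Lc p q) => //; exists (1, 1). Qed.

Lemma span_closedB L p q : span_closed L -> L p -> L q -> L (p - q).
Proof.
by move=> Lc Lp Lq; apply: (Lc p q) => //; exists (1, -1) => //=; rewrite mulrN1z.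
Qed.

Lemma span_closed_int_span e f : span_closed (int_span e f).
Proof.
move=> _ _ [m _ <-] [n _ <-] _ [i _ <-].
exists (m.1 * i.1 + n.1 * i.2, m.2 * i.1 + n.2 * i.2) => //=.
by rewrite !mulrzDl !mulrzDr -!mulrzA addrACA.
Qed.

Lemma int_span_gens e f : int_span e f e /\ int_span e f f.
Proof.
by split; [exists (1, 0)|exists (0, 1)]; rewrite //= mulr0z ?addr0 ?add0r.
Qed.

Lemma int_spanP e f p : int_span e f p <->
  exists m n : int, p = (m%:~R * e.1 + n%:~R * f.1, m%:~R * e.2 + n%:~R * f.2).
Proof.
split=> [[[m n] _ <-]|[m [n ->]]]; first by exists m, n; rewrite int_combE.
by exists (m, n) => //=; rewrite int_combE.
Qed.

Lemma det2_int_span e f b c : int_span e f b -> int_span e f c ->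
  exists m : int, det2 b c = m%:~R * det2 e f.
Proof.
move=> /int_spanP[m [n ->]] /int_spanP[i [j ->]].
exists (m * j - n * i); rewrite /det2 /= rmorphB !rmorphM /=; ring.
Qed.

(** Two bases of the same lattice are integer combinations of each other, so the
determinants of the two changes of basis are mutually inverse integers. *)
Lemma lattice_detE L e f : is_lattice_basis L e f -> lattice_det L = `|det2 e f|.
Proof.
move=> Lef; apply: xget_unique; first by exists e, f.
move=> _ [b [c [[bc0 Lbc] ->]]]; case: Lef => ef0 Lef.
have [efb efc] : int_span e f b /\ int_span e f c by rewrite -Lef Lbc; apply: int_span_gens.
have [bce bcf] : int_span b c e /\ int_span b c f by rewrite -Lbc Lef; apply: int_span_gens.
have [m mE] := det2_int_span efb efc.
have [n nE] := det2_int_span bce bcf.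
have : (m * n)%:~R * det2 b c = 1 * det2 b c by rewrite mul1r {2}mE nE rmorphM mulrA.
move=> /(mulIf bc0) /eqP; rewrite -[1]/(1%:~R) eqr_int => /eqP mn.
have m1 : `|m| = 1.
  have := congr1 absz mn; rewrite abszM => /eqP.
  by rewrite muln_eq1 => /andP[/eqP + _]; lia.
by rewrite mE normrM -intr_norm m1 mul1r.
Qed.

(** * Empty boxes and straddling pairs *)

Definition straddling e f := [/\ 0 < e.1, 0 < e.2, 0 < f.1 & f.2 < 0].

Definition box_free L (a1 b1 a2 b2 : R) :=
  forall p, L p -> a1 < p.1 < b1 -> a2 < p.2 < b2 -> False.

(** Inside the strip between a1 and b1, whose width exceeds e.1 + f.1, every
lattice point can be moved by e or by - f without leaving the strip.  Both moves
go up, by at most the maximum of e.2 and - f.2, so that a climb starting below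
the box cannot jump over a box of larger height. *)
Lemma box_free_height_le L e f a1 b1 a2 b2 :
  span_closed L -> L e -> L f -> straddling e f -> box_free L a1 b1 a2 b2 ->
  e.1 + f.1 < b1 - a1 -> b2 - a2 <= Num.max e.2 (- f.2).
Proof.
move=> Lc Le Lf [e1 e2 f1 f2] Lbox wide; rewrite leNgt; apply/negP.
rewrite gt_max => /andP[he hf].
pose c := Num.min e.2 (- f.2).
have ce : c <= e.2 by rewrite ge_min lexx.
have cf : c <= - f.2 by rewrite ge_min lexx orbT.
have c0 : 0 < c by rewrite lt_min e2 oppr_gt0.
have climb n p : L p -> a1 < p.1 < b1 -> p.2 <= a2 -> ~ a2 < p.2 + c *+ n.
  elim: n p => [|n IH] p Lp /andP[pa pb] p2; first by rewrite mulr0n; lra.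
  rewrite mulrS => hn.
  have hit q : L q -> a1 < q.1 < b1 -> q.2 < b2 -> p.2 + c <= q.2 -> False.
    move=> Lq q1 qb qc; have [qa|qa] := leP q.2 a2.
      by apply: (IH q) => //; lra.
    by apply: (Lbox q) => //; rewrite qa qb.
  have [r|r] := ltP (p.1 + e.1) b1.
    apply: (hit (p + e)); first exact: span_closedD.
    - by rewrite r andbT; have -> : (p + e).1 = p.1 + e.1 by []; lra.
    - by have -> : (p + e).2 = p.2 + e.2 by []; lra.
    - by have -> : (p + e).2 = p.2 + e.2 by []; lra.
  apply: (hit (p - f)); first exact: span_closedB.
  - by have -> : (p - f).1 = p.1 - f.1 by []; lra.
  - by have -> : (p - f).2 = p.2 - f.2 by []; lra.
  - by have -> : (p - f).2 = p.2 - f.2 by []; lra.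
(* A starting point p below the box: going k steps along - e, with k large, then
   back into the strip along f, which lowers the point further. *)
pose K := `|a1| / e.1 + `|a2| / e.2.
have K1 : 0 <= `|a1| / e.1 by rewrite divr_ge0// ltW.
have K2 : 0 <= `|a2| / e.2 by rewrite divr_ge0// ltW.
pose k := Num.bound K.
have kK : K < k%:R by apply: archi_boundP; rewrite addr_ge0.
have k1 : `|a1| <= k%:R * e.1 by rewrite -ler_pdivrMr//; rewrite /K in kK; lra.
have k2 : `|a2| <= k%:R * e.2 by rewrite -ler_pdivrMr//; rewrite /K in kK; lra.
have a1n := lerNnormlW (lexx `|a1|).
have a2n := lerNnormlW (lexx `|a2|).
pose l := Num.floor ((a1 + k%:R * e.1) / f.1) + 1.
have /andP[l1 l2] := floor_itv ((a1 + k%:R * e.1) / f.1).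
have l0 : 0 <= l%:~R :> R.
  apply: le_trans (ltW l2); rewrite divr_ge0 ?(ltW f1)//; lra.
rewrite ler_pdivlMr// in l1; rewrite ltr_pdivrMr// -/l in l2.
have lE : l%:~R = (Num.floor ((a1 + k%:R * e.1) / f.1))%:~R + 1 :> R.
  by rewrite /l intrD.
pose p := e *~ (- k%:Z) + f *~ l.
have [p1E p2E] : p.1 = - (k%:R * e.1) + l%:~R * f.1 /\
    p.2 = - (k%:R * e.2) + l%:~R * f.2.
  by rewrite /p int_combE /= mulrNz pmulrn !mulNr.
have lf : l%:~R * f.2 <= 0 by rewrite mulr_ge0_le0// ltW.
have p2 : p.2 <= a2 by lra.
have pa : 0 <= (a2 - p.2) / c by rewrite divr_ge0 ?(ltW c0)//; lra.
apply: (climb (Num.bound ((a2 - p.2) / c)) p) => //.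
- by apply: (Lc e f) => //; exists (- k%:Z, l).
- rewrite p1E; rewrite lE in l2 *; lra.
- have := archi_boundP pa; rewrite ltr_pdivrMr// mulr_natl; lra.
Qed.

Definition box_area_bound (D r : R) := (D / 2 + 1) ^+ 2 - r / 4.

(** With a, b and c' the coefficients of the norm form in the basis (e, f), the
area is a - c' + det2 f e.  The bound comes from (a - 1) (- c' - 1) >= 0 and
b^2 >= r, the discriminant of the form being det2 f e ^ 2. *)
Lemma straddling_area_le e f (r k : int) :
  straddling e f ->
  e.1 * e.2 \is a Num.int -> f.1 * f.2 \is a Num.int ->
  e.1 * f.2 + e.2 * f.1 \is a Num.int ->
  r = 0 \/ r = 1 -> det2 f e ^+ 2 = (r + 4 * k)%:~R ->
  (e.1 + f.1) * (e.2 - f.2) <= box_area_bound (det2 f e) r%:~R.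
Proof.
move=> [e1 e2 f1 f2] /intrP[a Ea] /intrP[c' Ec] /intrP[b Eb] r01.
have -> : det2 f e = f.1 * e.2 - f.2 * e.1 by [].
set D := _ - _ => ED.
have a0 : 0 < a by rewrite -(ltr0z R) -Ea mulr_gt0.
have c0 : c' < 0 by rewrite -(ltrz0 R) -Ec pmulr_rlt0.
have EDb : D ^+ 2 = b%:~R ^+ 2 - 4 * a%:~R * c'%:~R.
  by rewrite -Ea -Ec -Eb /D; ring.
have disc : r + 4 * k = b ^+ 2 - 4 * a * c'.
  by apply: (@intr_inj R); rewrite -ED EDb !(rmorphD, rmorphB, rmorphM, rmorphXn, rmorphN).
have rb : r <= b ^+ 2.
  case: r01 => rE; rewrite rE in disc *; first exact: sqr_ge0.
  have : b != 0 by apply/eqP => b0; rewrite b0 in disc; lia.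
  by rewrite -sqrf_eq0; have := sqr_ge0 b; lia.
have key : 4 * (a - c') <= 4 + (r + 4 * k) - r.
  have : 0 <= (a - 1) * (- c' - 1) by apply: mulr_ge0; lia.
  by lia.
have -> : (e.1 + f.1) * (e.2 - f.2) = a%:~R - c'%:~R + D.
  by rewrite -Ea -Ec /D; ring.
move: key; rewrite -(ler_int R) !(rmorphD, rmorphB, rmorphM, rmorphXn, rmorphN) /=.
rewrite !(rmorphD, rmorphB, rmorphM, rmorphXn, rmorphN) /= in ED.
rewrite /box_area_bound.
have -> : (D / 2 + 1) ^+ 2 = D ^+ 2 / 4 + D + 1 by field.
rewrite ED; lra.
Qed.

(** * The chain of straddling pairs *)

Section NormLattice.
Variables (L : set (R * R)) (D : R) (r k : int).
Hypothesis Lc : span_closed L.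
Hypothesis LN : forall p, L p -> p.1 * p.2 \is a Num.int.
Hypothesis Dirr : D \isn't a Num.int.
Hypothesis r01 : r = 0 \/ r = 1.
Hypothesis DE : D ^+ 2 = (r + 4 * k)%:~R.

Lemma lattice_straddling_area_le e f : L e -> L f -> straddling e f -> det2 f e = D ->
  (e.1 + f.1) * (e.2 - f.2) <= box_area_bound D r%:~R.
Proof.
move=> Le Lf s ED; rewrite -ED; apply: (straddling_area_le (k := k)) => //.
- exact: LN.
- exact: LN.
- have -> : e.1 * f.2 + e.2 * f.1 = (e + f).1 * (e + f).2 - e.1 * e.2 - f.1 * f.2.
    have [-> ->] : (e + f).1 = e.1 + f.1 /\ (e + f).2 = e.2 + f.2 by [].
    ring.
  by rewrite !rpredB ?LN//; apply: span_closedD.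
- by rewrite ED.
Qed.

(** One step of the chain.  The sum e + f lies off the horizontal axis, as
otherwise D would be the integer e.1 * e.2 - f.1 * f.2; it replaces e or f
according to its side of the axis.  Widths grow by at least min(e.1, f.1), which
does not decrease along the chain, so that the chain outgrows any width. *)
Lemma straddling_step e f : L e -> L f -> straddling e f -> det2 f e = D ->
  exists e' f', [/\ L e', L f', straddling e' f', det2 f' e' = D &
    [/\ e'.2 - f'.2 = Num.max e.2 (- f.2),
        Num.min e.1 f.1 <= e'.1, Num.min e.1 f.1 <= f'.1 &
        e.1 + f.1 + Num.min e.1 f.1 <= e'.1 + f'.1]].
Proof.
move=> Le Lf s ED; have [e1 e2 f1 f2] := s.
have Lg : L (e + f) by apply: span_closedD.
have g1 : (e + f).1 = e.1 + f.1 by [].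
have g2 : (e + f).2 = e.2 + f.2 by [].
have me : Num.min e.1 f.1 <= e.1 by rewrite ge_min lexx.
have mf : Num.min e.1 f.1 <= f.1 by rewrite ge_min lexx orbT.
rewrite /det2 in ED *.
have [lt|gt|eq] := ltgtP (e.2 + f.2) 0.
- exists e, (e + f); rewrite /straddling /det2 g1 g2; split => //.
  + by split => //; lra.
  + by rewrite -ED; ring.
  + split; try lra.
    by rewrite max_r; lra.
- exists (e + f), f; rewrite /straddling /det2 g1 g2; split => //.
  + by split => //; lra.
  + by rewrite -ED; ring.
  + split; try lra.
    by rewrite max_l; lra.
- case/negP: Dirr.
  have -> : D = e.1 * e.2 - f.1 * f.2.
    by rewrite -ED; have -> : f.2 = - e.2 by [lra]; ring.
  by rewrite rpredB ?LN.
Qed.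

(** The chain is followed up to the first pair (e', f') at least as wide as the
box; the height of the box is bounded through the pair just before it. *)
Lemma wide_box_area_le e f a1 b1 a2 b2 :
  L e -> L f -> straddling e f -> det2 f e = D ->
  box_free L a1 b1 a2 b2 -> e.1 + f.1 < b1 - a1 -> a2 < b2 ->
  (b1 - a1) * (b2 - a2) <= box_area_bound D r%:~R.
Proof.
move=> Le Lf s ED Lbox wide ab2.
pose c := Num.min e.1 f.1.
have c0 : 0 < c by case: s => *; rewrite lt_min; apply/andP.
have w0 : 0 <= (b1 - a1) / c.
  by rewrite divr_ge0 ?(ltW c0)//; case: s => *; lra.
have := archi_boundP w0; set n := Num.bound _; rewrite ltr_pdivrMr// mulr_natl.
have [ce cf] : c <= e.1 /\ c <= f.1 by rewrite !ge_min !lexx orbT.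
have : 0 < e.1 + f.1 by case: s => *; lra.
move: ce cf => + + ef0 bn; have {bn ef0} : b1 - a1 <= e.1 + f.1 + c *+ n by lra.
clearbody n; clearbody c; clear w0.
elim: n e f Le Lf s ED wide => [|n IH] e f Le Lf s ED wide; first by rewrite mulr0n; lra.
rewrite mulrS => wn ce cf.
have [e' [f' [Le' Lf' s' ED' [H' m1 m2 m3]]]] := straddling_step Le Lf s ED.
have mc : c <= Num.min e.1 f.1 by rewrite le_min; apply/andP.
have [lt|ge] := ltP (e'.1 + f'.1) (b1 - a1).
  by apply: (IH e' f') => //; lra.
apply: le_trans (lattice_straddling_area_le Le' Lf' s' ED').
apply: ler_pM => //; try (case: s => *; lra).
by rewrite H'; apply: (box_free_height_le Lc Le Lf s Lbox).
Qed.

End NormLattice.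

(** * Dispersion from a straddling basis *)

Definition swap_set L : set (R * R) := [set p | L (p.2, p.1)].

(** If the box is narrower than that of (e, f) but taller, it becomes wide after
exchanging the coordinates, which turns the straddling pair (e, f) into the
straddling pair formed by the mirror images of e and - f. *)
Lemma box_area_le L (D : R) (r k : int) e f a1 b1 a2 b2 :
  span_closed L -> (forall p, L p -> p.1 * p.2 \is a Num.int) ->
  D \isn't a Num.int -> r = 0 \/ r = 1 -> D ^+ 2 = (r + 4 * k)%:~R ->
  L e -> L f -> straddling e f -> det2 f e = D ->
  a1 < b1 -> a2 < b2 -> box_free L a1 b1 a2 b2 ->
  (b1 - a1) * (b2 - a2) <= box_area_bound D r%:~R.
Proof.
move=> Lc LN Dirr r01 DE Le Lf s ED ab1 ab2 Lbox.
have [lt|le1] := ltP (e.1 + f.1) (b1 - a1).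
  exact: (wide_box_area_le Lc LN Dirr r01 DE Le Lf s ED).
have [lt|le2] := ltP (e.2 - f.2) (b2 - a2); last first.
  apply: le_trans (lattice_straddling_area_le Lc LN r01 DE Le Lf s ED).
  by apply: ler_pM => //; lra.
have [e1 e2 f1 f2] := s.
rewrite mulrC.
apply: (@wide_box_area_le (swap_set L) _ _ k _ _ Dirr r01 DE (e.2, e.1) (- f.2, - f.1)).
- move=> p q Lp Lq _ [m _ <-]; rewrite /swap_set /=.
  apply: (Lc _ _ Lp Lq); exists m => //.
  by apply/pair_equal_spec; rewrite !(raddfD, raddfMz).
- by move=> p /LN /=; rewrite mulrC.
- by rewrite /swap_set /= -surjective_pairing.
- have := span_closedB Lc (span_closedB Lc Lf Lf) Lf.
  by rewrite subrr sub0r.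
- by split => //=; lra.
- by rewrite -ED /det2 /=; ring.
- by move=> p Lp p1 p2; apply: (Lbox (p.2, p.1)).
- by rewrite /=; lra.
- by [].
Qed.

(** For m e + n f, the horizontal inequalities exclude that m and n are both
positive or both nonpositive, and the vertical ones exclude the other two sign
patterns. *)
Lemma straddling_box_free e f : straddling e f ->
  box_free (int_span e f) 0 (e.1 + f.1) f.2 e.2.
Proof.
move=> [e1 e2 f1 f2] _ /int_spanP[m [n ->]] /= /andP[lo1 hi1] /andP[lo2 hi2].
have pos (i : int) : 0 < i -> 1 <= i%:~R :> R by rewrite ler1z; lia.
have neg (i : int) : ~ 0 < i -> i%:~R <= 0 :> R by rewrite lerz0; lia.
have [/pos m1|/neg m1] := pselect (0 < m);
  have [/pos n1|/neg n1] := pselect (0 < n); nra.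
Qed.

Lemma disp_eq L D r k e f :
  L = int_span e f -> (forall p, L p -> p.1 * p.2 \is a Num.int) ->
  D \isn't a Num.int -> r = 0 \/ r = 1 -> D ^+ 2 = (r + 4 * k)%:~R ->
  straddling e f -> det2 f e = D ->
  (e.1 + f.1) * (e.2 - f.2) = box_area_bound D r%:~R ->
  disp L = (box_area_bound D r%:~R)%:E.
Proof.
move=> LE LN Dirr r01 DE s ED A.
have Lc : span_closed L by rewrite LE; apply: span_closed_int_span.
have [Le Lf] : L e /\ L f.
  by rewrite LE; apply: int_span_gens.
apply/eqP; rewrite eq_le; apply/andP; split.
  apply: ge_ereal_sup => _ [a1 [b1 [a2 [b2 [ab1 ab2 E ->]]]]].
  rewrite lee_fin; apply: (box_area_le Lc LN Dirr r01 DE Le Lf s ED) => //.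
  move=> p Lp p1 p2; suff: set0 p by []; rewrite -E.
  by split => //; split; rewrite /= in_itv.
apply: ereal_sup_ubound; exists 0, (e.1 + f.1), f.2, e.2.
case: (s) => e1 e2 f1 f2; split; [lra|lra| |by rewrite -A subr0].
apply/seteqP; split => // p [[]]; rewrite /= !in_itv /= LE => p1 p2 Lp.
exact: (straddling_box_free s Lp).
Qed.

End PlaneLattices.

(** * Real quadratic integers *)

Section QuadraticIntegers.
Context {R : realType}.
Variable d : nat.
Implicit Types (a b : rat * rat) (p : {poly int}).

Local Notation val a := (@quad_val R d a).
Local Notation conj_val a := (@quad_val R d (quad_conj a)).
Local Notation eval p x := (map_poly (intr : int -> R) p).[x].

(** Gauss's lemma: 'X - q divides a monic integer polynomial, so it is up to a
rational factor an integer polynomial with leading coefficient 1 or - 1. *)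
Lemma integral_rat_int (q : rat) :
  integralOver (intr : int -> R) (ratr q) -> q \is a Num.int.
Proof.
case=> p p_monic; rewrite (_ : map_poly intr p = map_poly ratr (map_poly intr p : {poly rat})).
  rewrite fmorph_root -dvdp_XsubCl => /dvdpP_rat_int[g [c c0 gE] [h pE]].
  have : lead_coef g * lead_coef h = 1 by rewrite -lead_coefM -pE (monicP p_monic).
  move=> gh; have g1 : lead_coef g = 1 \/ lead_coef g = -1.
    have := congr1 absz gh; rewrite abszM => /eqP.
    by rewrite muln_eq1 => /andP[/eqP + _]; lia.
  have sg : size g = 2.
    by have := congr1 (fun u : {poly rat} => size u) gE; rewrite size_scale// size_rat_int_poly size_XsubC.
  have := congr1 (fun u : {poly rat} => u`_1) gE.
  have := congr1 (fun u : {poly rat} => u`_0) gE.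
  rewrite /= !coefB !coefX !coefC !coefZ !coef_map /= sub0r subr0.
  move: g1; rewrite lead_coefE sg /= => -[-> | ->] q0 c1.
    have -> : q = - (g`_0)%:~R by rewrite -[LHS]opprK q0; rewrite mulr1 in c1; rewrite -c1 mul1r.
    by rewrite rpredN rpred_int.
  have -> : q = (g`_0)%:~R.
    by rewrite -[LHS]opprK q0 -mulNr; rewrite mulrN1 in c1; rewrite -c1 mul1r.
  exact: rpred_int.
by rewrite -map_poly_comp; apply: eq_map_poly => x /=; rewrite ratr_int.
Qed.

(** Conjugation commutes with integer polynomials.  Since conjugation acts on
pairs of rationals, this is expressed by a common pair b of coordinates. *)
Lemma horner_quad p a : exists b, eval p (val a) = val b /\
  eval p (conj_val a) = conj_val b.
Proof.
have s2 : Num.sqrt d%:R ^+ 2 = d%:R :> R by rewrite sqr_sqrtr.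
elim/poly_ind: p => [|p c [b [E E']]].
  by exists (0, 0); rewrite map_poly0 !horner0 /quad_val /= oppr0 !rmorph0 mul0r addr0.
exists (b.1 * a.1 + b.2 * a.2 * d%:R + c%:~R, b.1 * a.2 + b.2 * a.1).
rewrite rmorphD rmorphM /= map_polyX map_polyC !hornerE E E' /quad_val /=.
rewrite !(rmorphD, rmorphM, rmorphN) /= ratr_int ratr_nat.
move: s2; set s := Num.sqrt _; clearbody s => <-.
by split; ring.
Qed.

(** A rational square root of d would be an integer m, whose square would divide
the square-free number d. *)
Lemma sqrt_irrational (q : rat) : (1 < d)%N -> squarefree d ->
  ratr q <> Num.sqrt d%:R :> R.
Proof.
move=> d_gt1 sqf E.
have q2 : q ^+ 2 = d%:R.
  by apply: (@fmorph_inj _ _ (@ratr R)); rewrite rmorphXn /= E sqr_sqrtr// ratr_nat.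
have /intrP[m mE] : q \is a Num.int.
  apply: integral_rat_int; exists ('X^2 - d%:R%:P).
    by rewrite monicE lead_coefDl ?lead_coefXn// size_polyXn size_polyN ltnS (leq_trans (size_polyC_leq1 _)).
  rewrite /root rmorphB /= map_polyXn map_polyC /= !hornerE -rmorphXn /= q2.
  by rewrite ratr_nat rmorph_nat subrr.
have md : (`|m| ^ 2 = d)%N.
  have : m ^+ 2 = d%:Z.
    by apply: (@intr_inj rat); rewrite rmorphXn /= -mE q2.
  by move=> /(congr1 absz); rewrite abszX.
have m1 : (1 < `|m|)%N.
  by rewrite ltnNge; apply/negP; move: md d_gt1; case: `|m|%N => [|[|k]] //= <-.
by have := sqf _ m1; rewrite md dvdnn.
Qed.

Lemma quad_val_inj : (1 < d)%N -> squarefree d -> injective (@quad_val R d).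
Proof.
move=> d_gt1 sqf [a1 a2] [b1 b2]; rewrite /quad_val /= => E.
have [E2|ne] := eqVneq a2 b2.
  by move: E; rewrite E2 => /addIr /fmorph_inj ->.
case: (@sqrt_irrational ((b1 - a1) / (a2 - b2)) d_gt1 sqf).
have ne' : ratr a2 - ratr b2 != 0 :> R by rewrite -rmorphB fmorph_eq0 subr_eq0.
rewrite fmorph_div !rmorphB /=; apply: (mulIf ne'); rewrite divfK//.
by rewrite mulrBr ![_ * ratr _]mulrC; lra.
Qed.

(** As u + v sqrt d determines (u, v), the conjugate of the value of a polynomial
at an element is the value of that polynomial at the conjugate element. *)
Lemma conj_lattice_adjoin a : (1 < d)%N -> squarefree d ->
  conj_lattice d (int_adjoin (val a)) =
  range (fun p => (eval p (val a), eval p (conj_val a))).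
Proof.
move=> d_gt1 sqf; apply/seteqP; split.
  move=> _ [b [p _ pE] <-]; exists p => //.
  have [c [E E']] := horner_quad p a.
  have bc : b = c by apply: (quad_val_inj d_gt1 sqf); rewrite -pE E.
  by rewrite E E' bc.
move=> _ [p _ <-]; have [c [E E']] := horner_quad p a.
by exists c; [exists p|rewrite E E'].
Qed.

Lemma quad_conj_integral a : (1 < d)%N -> squarefree d ->
  integralOver (intr : int -> R) (val a) ->
  integralOver (intr : int -> R) (conj_val a).
Proof.
move=> d_gt1 sqf [p mp /rootP pa]; exists p => //; apply/rootP.
have [b [E ->]] := horner_quad p a.
have -> : b = (0, 0).
  by apply: (quad_val_inj d_gt1 sqf); rewrite -E pa /quad_val /= !rmorph0 mul0r addr0.
by rewrite /quad_val /= oppr0 !rmorph0 mul0r addr0.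
Qed.

(** The trace and the norm are integral over the integers because the conjugate
is, and they are rational. *)
Lemma quad_integer_trace_norm a : (1 < d)%N -> squarefree d ->
  integralOver (intr : int -> R) (val a) ->
  exists t n : int, val a + conj_val a = t%:~R /\ val a * conj_val a = n%:~R.
Proof.
move=> d_gt1 sqf ia; have ic := quad_conj_integral d_gt1 sqf ia.
have s2 : Num.sqrt d%:R ^+ 2 = d%:R :> R by rewrite sqr_sqrtr.
have tE : val a + conj_val a = ratr (a.1 *+ 2).
  by rewrite /quad_val /= rmorphN rmorphMn /=; ring.
have nE : val a * conj_val a = ratr (a.1 ^+ 2 - a.2 ^+ 2 * d%:R).
  rewrite /quad_val /= rmorphN !(rmorphB, rmorphM, rmorphXn) /= ratr_nat.
  move: s2; set s := Num.sqrt _; clearbody s => <-; ring.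
have /intrP[t te] : a.1 *+ 2 \is a Num.int.
  by apply: integral_rat_int; rewrite -tE; apply: integral_add.
have /intrP[n ne] : a.1 ^+ 2 - a.2 ^+ 2 * d%:R \is a Num.int.
  by apply: integral_rat_int; rewrite -nE; apply: integral_mul.
by exists t, n; rewrite tE nE te ne !ratr_int.
Qed.

End QuadraticIntegers.

(** * The lattice of a quadratic order *)

Section QuadraticOrder.
Context {R : realType}.
Local Notation eval p x := (map_poly (intr : int -> R) p).[x].

(** Powers reduce to Z + Z x by the relation x^2 = t x - n, which x' satisfies as
well.  The generator x is replaced by x0 + y0 x, with y0 = 1 or - 1, so that its
trace and the sign of its conjugate can be chosen. *)
Lemma adjoin_pairs_span (x x' : R) (t n x0 y0 : int) :
  x + x' = t%:~R -> x * x' = n%:~R -> y0 ^+ 2 = 1 ->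
  range (fun p : {poly int} => (eval p x, eval p x')) =
  int_span (1, 1) (x0%:~R + y0%:~R * x, x0%:~R + y0%:~R * x').
Proof.
move=> tE nE y2; apply/seteqP; split.
  move=> _ [p _ <-]; apply/int_spanP => /=.
  suff [i [j [-> ->]]] : exists i j : int,
      eval p x = i%:~R + j%:~R * x /\ eval p x' = i%:~R + j%:~R * x'.
    exists (i - j * y0 * x0), (j * y0).
    rewrite rmorphB !rmorphM /=.
    have y2' : y0%:~R ^+ 2 = 1 :> R by rewrite -rmorphXn /= y2.
    have change z : i%:~R + j%:~R * z = (i%:~R - j%:~R * y0%:~R * x0%:~R) * 1 +
        j%:~R * y0%:~R * (x0%:~R + y0%:~R * z) :> R.
      transitivity (i%:~R + j%:~R * y0%:~R ^+ 2 * z); last by ring.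
      by rewrite y2' mulr1.
    by rewrite -!change.
  elim/poly_ind: p => [|p c [i [j [E E']]]].
    by exists 0, 0; rewrite map_poly0 !horner0 !mul0r addr0.
  exists (c - j * n), (i + j * t).
  rewrite rmorphD rmorphM /= map_polyX map_polyC !hornerE E E' /=.
  rewrite !(rmorphD, rmorphM, rmorphN) /= -tE -nE.
  by split; ring.
move=> _ /int_spanP[i [j ->]] /=.
exists (i%:P + j%:P * (x0%:P + y0%:P * 'X)) => //.
by rewrite !(rmorphD, rmorphM) /= map_polyX !map_polyC !hornerE.
Qed.

(** The basis of 1 and a generator with trace r in {0, 1}.  As D^2 is a positive
integer and D is not an integer, D > 1 >= r, which gives x = (r + D) / 2 > 0 and
x' = (r - D) / 2 < 0.  Its box has area 1 + D - x x' = 1 + D + (D^2 - r) / 4. *)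
Lemma unit_basis_disp (x x' : R) (r k : int) :
  r = 0 \/ r = 1 -> x + x' = r%:~R -> x * x' = - k%:~R ->
  0 < x - x' -> x - x' \isn't a Num.int ->
  let L := int_span (1, 1) (x, x') in
  lattice_det L = x - x' /\ disp L = (box_area_bound (x - x') r%:~R)%:E.
Proof.
move=> r01 tE nE D0 Dirr L; set D := x - x' in D0 Dirr *.
have r2 : r%:~R ^+ 2 = r%:~R :> R by case: r01 => ->; rewrite ?expr0n ?expr1n.
have DE : D ^+ 2 = (r + 4 * k)%:~R.
  have -> : D ^+ 2 = (x + x') ^+ 2 - 4 * (x * x') by rewrite /D; ring.
  by rewrite tE nE r2 rmorphD rmorphM /=; ring.
have D1 : 1 < D.
  rewrite lt_neqAle; apply/andP; split.
    by apply/eqP => D1; move: Dirr; rewrite -D1 rpred1.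
  rewrite -(ler_pXn2r (n := 2)) ?nnegrE ?(ltW D0)// expr1n DE ler1z.
  have : 0 < (r + 4 * k)%:~R :> R by rewrite -DE exprn_gt0.
  by rewrite ltr0z; lia.
have r0 : 0 <= (r%:~R : R) <= 1 by case: r01 => ->; rewrite ?lexx ?ler01.
have s : straddling (1, 1) (x, x').
  by split => //=; rewrite ?ltr01//; move: r0; rewrite -tE => /andP[]; rewrite /D in D1 *; lra.
split.
  rewrite (@lattice_detE _ L (1, 1) (x, x')).
    by rewrite /det2 /= !mul1r distrC ger0_norm// ltW.
  by split => //; rewrite /det2 /= !mul1r -oppr_eq0 opprB gt_eqF.
apply: (@disp_eq _ L D r k (1, 1) (x, x')) => //.
- move=> _ /int_spanP[i [j ->]] /=.
  have -> : (i%:~R * 1 + j%:~R * x) * (i%:~R * 1 + j%:~R * x') =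
      i%:~R ^+ 2 + i%:~R * j%:~R * (x + x') + j%:~R ^+ 2 * (x * x') by ring.
  by rewrite tE nE !(rpredD, rpredM, rpredX, rpredN, rpred_int).
- by rewrite /det2 /= !mulr1.
- have -> : (1 + x) * (1 - x') = 1 + D - x * x' by rewrite /D; ring.
  have -> : box_area_bound D r%:~R = D ^+ 2 / 4 + D + 1 - r%:~R / 4.
    by rewrite /box_area_bound; field.
  by rewrite DE nE rmorphD rmorphM /=; field.
Qed.

End QuadraticOrder.

Theorem theorem4p5 (R : realType) (d : nat) (delta : R)
  (d_gt1 : (1 < d)%N) (d_sqf : squarefree d)
  (delta_notin_Z : forall m : int, delta <> m%:~R)
  (order_sub : int_adjoin delta `<=` quad_integers d) :
  let O := int_adjoin delta in
  let L := conj_lattice d O in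
  exists r : int,
    [/\ r = 0 \/ r = 1,
        exists n : int, lattice_det L ^+ 2 = n%:~R /\ (r = n %[mod 2])%Z,
        disp L = ((lattice_det L / 2 + 1) ^+ 2 - r%:~R / 4)%:E
      & disp L = ((Num.sqrt (order_disc d O) / 2 + 1) ^+ 2 - r%:~R / 4)%:E].
Proof.
move=> O L.
have [[a _ aE] int_delta] : quad_integers d delta.
  by apply: order_sub; exists 'X => //; rewrite map_polyX hornerX.
rewrite -aE in int_delta.
have [t [n [tE nE]]] := quad_integer_trace_norm d_gt1 d_sqf int_delta.
set x := quad_val d a in int_delta tE nE aE.
set x' := quad_val d (quad_conj a) in tE nE.
have a2 : a.2 != 0.
  apply/eqP => a2; have xE : x = ratr a.1 by rewrite /x /quad_val a2 rmorph0 mul0r addr0.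
  have /intrP[m mE] : a.1 \is a Num.int by apply: (@integral_rat_int R); rewrite -xE.
  by apply: (delta_notin_Z m); rewrite -aE xE mE ratr_int.
(* The sign y makes y (x - x') positive; the translation by - q, where q is the
   quotient of y t by 2, then brings the trace of y x down to its parity r. *)
pose y : int := sgz a.2.
have y2 : y ^+ 2 = 1 by rewrite /y; case: sgzP a2.
have s0 : 0 < Num.sqrt d%:R :> R by rewrite sqrtr_gt0 ltr0n; lia.
have DE : y%:~R * (x - x') = ratr (`|a.2| *+ 2) * Num.sqrt d%:R :> R.
  have -> : x - x' = ratr a.2 * 2 * Num.sqrt d%:R.
    by rewrite /x /x' /quad_val /= rmorphN; ring.
  rewrite rmorphMn /= normrEsg rmorphM /= sgrEz ratr_int -/y; ring.
pose q := (y * t %/ 2)%Z; pose r := (y * t %% 2)%Z.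
have ytE : y * t = q * 2 + r by apply: divz_eq.
have r01 : r = 0 \/ r = 1.
  have := ltz_pmod (y * t) (isT : 0 < 2 :> int).
  by have := modz_ge0 (y * t) (isT : 2 != 0 :> int); rewrite -/r; lia.
clearbody q r; exists r.
pose w := (- q)%:~R + y%:~R * x; pose w' := (- q)%:~R + y%:~R * x'.
have y2R : y%:~R ^+ 2 = 1 :> R by rewrite -rmorphXn /= y2.
have wD : w - w' = y%:~R * (x - x') by rewrite /w /w'; ring.
have LE : L = int_span (1, 1) (w, w').
  rewrite /L /O -aE (conj_lattice_adjoin a d_gt1 d_sqf).
  exact: (adjoin_pairs_span _ tE nE y2).
pose k := q ^+ 2 + q * r - n.
have ytR : y%:~R * (x + x') = q%:~R * 2 + r%:~R :> R by rewrite tE -rmorphM /= ytE rmorphD rmorphM.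
have ww' : w * w' = - k%:~R.
  have -> : w * w' = q%:~R ^+ 2 - q%:~R * (y%:~R * (x + x')) + y%:~R ^+ 2 * (x * x').
    by rewrite /w /w' rmorphN; ring.
  by rewrite ytR y2R nE !(rmorphD, rmorphB, rmorphM, rmorphXn, rmorphN) /=; ring.
have wDw' : w + w' = r%:~R.
  by rewrite -[RHS](addKr (q%:~R * 2)) -ytR /w /w' rmorphN; ring.
have u0 : `|a.2| *+ 2 != 0 by rewrite mulrn_eq0 normr_eq0.
have D0 : 0 < w - w' by rewrite wD DE mulr_gt0// ltr0q pmulrn_lgt0// normr_gt0.
have Dirr : w - w' \isn't a Num.int.
  apply/negP; rewrite wD DE => /intrP[m mE].
  apply: (@sqrt_irrational R d (m%:~R / (`|a.2| *+ 2)) d_gt1 d_sqf).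
  have u0' : ratr (`|a.2| *+ 2) != 0 :> R by rewrite fmorph_eq0.
  by rewrite fmorph_div /= ratr_int -mE mulrAC divff// mul1r.
have [detE dispE] := unit_basis_disp r01 wDw' ww' D0 Dirr.
rewrite -LE in detE dispE.
have sqE : Num.sqrt (order_disc d O) = lattice_det L.
  by rewrite /order_disc sqrtr_sqr ger0_norm// detE ltW.
rewrite sqE detE; split => //.
exists (r ^+ 2 + 4 * k); split.
  have -> : (w - w') ^+ 2 = (w + w') ^+ 2 - 4 * (w * w') by ring.
  by rewrite wDw' ww' !(rmorphD, rmorphXn, rmorphM) /=; ring.
by case: r01 => ->; lia.
Qed.
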